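(* Let $(E, \mathcal{P})$ be an abstract network and let $\rho, \mu \in [0,1]^E$ satisfy $\sum_{e \in P} \rho_e \ge \pi_P := 1 - \sum_{e \in P} \mu_e$ for all $P \in \mathcal{P}$. For $e \in E$ define $\alpha'_e := \min\{\sum_{f \in (Q,e)} (\mu_f + \rho_f) : Q \in \mathcal{P},\ e \in Q\}$ and $\alpha_e := \min\{\alpha'_e, 1 - \rho_e\}$. For $\tau$ drawn uniformly at random from $[0,1]$, let $S_\tau := \{e \in E : \alpha_e \le \tau < \alpha_e + \rho_e\}$. Then $x$ defined by $x_S := \Pr[S_\tau = S]$ for $S \subseteq E$ is a feasible decomposition of $\rho$ for $(E,\mathcal{P},\pi)$.
   Context: An abstract network is a pair $(E,\mathcal{P})$ with $E$ a finite set and $\mathcal{P} \subseteq 2^E$, where each $P \in \mathcal{P}$ (an abstract path) carries a linear order $\preceq_P$ of its elements, such that for all $P, Q \in \mathcal{P}$ and all $e \in P \cap Q$ there exists $R \in \mathcal{P}$ with $R \subseteq \{p \in P : p \preceq_P e\} \cup \{q \in Q : e \preceq_Q q\}$. For $P \in \mathcal{P}$ and $e \in P$, $(P, e) := \{p \in P : p \prec_P e\}$. The minimum over an empty set is $+\infty$. A feasible decomposition of $\rho \in [0,1]^E$ for $(E,\mathcal{P},\pi)$, $\pi \in [0,1]^{\mathcal{P}}$, is a vector $x \in \mathbb{R}^{2^E}$ with $x_S \ge 0$, $\sum_{S} x_S = 1$, $\sum_{S : e \in S} x_S = \rho_e$ for all $e\in E$, and $\sum_{S : S \cap P \ne \emptyset}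 x_S \ge \pi_P$ for all $P \in \mathcal{P}$. *)

(* Defs.v *)
From HB Require Import structures.
From mathcomp Require Import all_boot all_order all_algebra.
From mathcomp Require Import all_classical all_reals all_analysis.

Set Implicit Arguments.
Unset Strict Implicit.
Unset Printing Implicit Defensive.

Import Order.TTheory GRing.Theory Num.Theory.

Local Open Scope ring_scope.

(* [network_le P] is only meaningful on the elements of a path [P]; reflexivity
   there follows from totality. *)
Record abstract_network (E : finType) := AbstractNetwork {
  paths : {set {set E}};
  network_le : {set E} -> rel E;
  network_le_anti : forall P : {set E}, P \in paths -> {in P &, antisymmetric (network_le P)};
  network_le_trans : forall P : {set E}, P \in paths -> {in P & &, transitive (network_le P)};
  network_le_total : forall P : {set E}, P \in paths -> {in P &, total (network_le P)};
  path_switch : forall (P Q : {set E}) e, P \in paths -> Q \in paths -> e \in P :&: Q ->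
    exists2 R : {set E}, R \in paths &
      R \subset [set p in P | network_le P p e] :|: [set q in Q | network_le Q e q]
}.

Definition path_before (E : finType) (N : abstract_network E)
    (P : {set E}) (e : E) : {set E} :=
  [set p in P | network_le N P p e & p != e].

(* The values of [pi] outside [paths N] are irrelevant. *)
Record feasible_decomposition (R : realType) (E : finType)
    (N : abstract_network E) (pi : {set E} -> R) (rho : E -> R)
    (x : {set E} -> R) : Prop := FeasibleDecomposition {
  decomposition_ge0 : forall S, 0 <= x S;
  decomposition_sum1 : \sum_(S : {set E}) x S = 1;
  decomposition_marginal : forall e, \sum_(S : {set E} | e \in S) x S = rho e;
  decomposition_cover : forall P : {set E}, P \in paths N ->
    pi P <= \sum_(S : {set E} | S :&: P != finset.set0) x S
}.

Section Decomposition.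
Variables (R : realType) (E : finType) (N : abstract_network E).
Variables (rho mu : E -> R).

Definition requirement (P : {set E}) : R := 1 - \sum_(e in P) mu e.

(* Valued in [\bar R] so that the minimum is [+oo] when no path contains [e]. *)
Definition alpha' (e : E) : \bar R :=
  \big[Order.min/+oo%E]_(Q in paths N | e \in Q)
    (\sum_(f in path_before N Q e) (mu f + rho f))%:E.

Definition alpha (e : E) : \bar R := Order.min (alpha' e) (1 - rho e)%:E.

Definition threshold_set (tau : R) : {set E} :=
  [set e | (alpha e <= tau%:E)%E && (tau%:E < alpha e + (rho e)%:E)%E].

Definition threshold_decomposition (S : {set E}) : R :=
  fine (uniform_prob (@ltr01 R) [set tau | threshold_set tau = S]%classic).

End Decomposition.

(* Main.v *)
Require Import Defs.
From HB Require Import structures.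
From mathcomp Require Import all_boot all_order all_algebra.
From mathcomp Require Import all_classical all_reals all_analysis.
From mathcomp Require Import lra.

(* All conditions reduce to the lengths of the intervals
   [I e = [alpha e, alpha e + rho e)], which lie in [0, 1]: a sum of [x S] over a
   family of sets [S] is the probability that [S_tau] belongs to the family.
   For the covering condition on a path [P], enlarge each [I e] by [mu e] to the
   right.  The enlarged intervals of the elements of [P] cover [0, 1), so the
   part of [0, 1) missed by the [I e] has length at most the sum of the [mu e]. *)

Import Order.TTheory GRing.Theory Num.Theory.

Set Implicit Arguments.
Unset Strict Implicit.

Local Open Scope ring_scope.

(** * Extremal elements of paths *)

(** An element [m] with the fewest predecessors in [A] works: if [r m x] failed, the predecessors of
    [x] would be among those of [m] but omit [m] itself. *)
Lemma exists_least (T : finType) (r : rel T) (A : {set T}) :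
  {in A & &, transitive r} -> {in A &, total r} -> A != finset.set0 ->
  exists2 m, m \in A & {in A, forall x, r m x}.
Proof.
move=> rtr rtot /set0Pn[x0 x0A].
case: (arg_minnP (fun x => #|[set y in A | r y x]|) x0A) => m mA0 mmin.
have mA : m \in A := mA0.
exists m => // x xA; apply: contraT => nrmx.
have rxm : r x m by have := rtot _ _ mA xA; rewrite (negbTE nrmx).
have := mmin _ xA; rewrite leqNgt => /negP[]; apply: proper_card.
apply/properP; split.
  apply/fintype.subsetP => y; rewrite !inE => /andP[yA ryx].
  by rewrite yA (rtr x).
exists m; rewrite !inE mA //=.
by have := rtot _ _ mA mA; rewrite orbb.
Qed.

Lemma path_first (E : finType) (N : abstract_network E) (P A : {set E}) :
  P \in paths N -> A \subset P -> A != finset.set0 ->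
  exists2 m, m \in A & {in A, forall x, network_le N P m x}.
Proof.
move=> PN /fintype.subsetP AP; apply: exists_least.
  by move=> x y z /AP xP /AP yP /AP zP; exact: (network_le_trans PN).
by move=> x y /AP xP /AP yP; exact: (network_le_total PN).
Qed.

Lemma path_last (E : finType) (N : abstract_network E) (P A : {set E}) :
  P \in paths N -> A \subset P -> A != finset.set0 ->
  exists2 m, m \in A & {in A, forall x, network_le N P x m}.
Proof.
move=> PN /fintype.subsetP AP.
apply: (@exists_least E (fun x y => network_le N P y x)).
  move=> x y z /AP xP /AP yP /AP zP yx xz.
  exact: (network_le_trans PN) xz yx.
by move=> x y /AP xP /AP yP; exact: (network_le_total PN).
Qed.

Lemma ler_sum_subset (R : numDomainType) (T : finType) (f : T -> R)
    (A B : {set T}) :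
  (forall x, 0 <= f x) -> A \subset B ->
  \sum_(x in A) f x <= \sum_(x in B) f x.
Proof.
move=> f0 AB; rewrite [leRHS](big_setID A)/= (finset.setIidPr AB).
by rewrite lerDl sumr_ge0.
Qed.

(** The cap [1 - rho e] keeps [alpha] finite even when no path contains [e], and keeps the interval
    of [e] inside [[0, 1]]. *)
Lemma alpha_finite (R : realType) (E : finType) (N : abstract_network E)
    (rho mu : E -> R) :
  (forall e, 0 <= rho e <= 1) -> (forall e, 0 <= mu e) ->
  exists a : E -> R, forall e,
    alpha N rho mu e = (a e)%:E /\ 0 <= a e <= 1 - rho e.
Proof.
move=> rho01 mu0; exists (fun e => fine (alpha N rho mu e)) => e.
have [r0 r1] := andP (rho01 e).
have le1 : (alpha N rho mu e <= (1 - rho e)%:E)%E.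
  by rewrite /alpha ge_min lexx orbT.
have ge0 : (0%:E <= alpha N rho mu e)%E.
  rewrite /alpha le_min lee_fin subr_ge0 r1 andbT.
  apply/bigmin_geP; split => [|Q _]; first exact: leey.
  rewrite lee_fin sumr_ge0 // => f _.
  by rewrite addr_ge0 //; case/andP: (rho01 f).
by move: le1 ge0; case: (alpha N rho mu e) => //= x; rewrite !lee_fin => -> ->.
Qed.

(* Take the last [e] in [P] with [alpha e <= tau].  If the interval of [e] ended
   before [tau], a path [Q] attaining [alpha' e] would have weight at most [tau]
   up to [e]; switching from [Q] to [P] at [e] yields a path of weight at least
   [1], hence one that leaves [Q], and its first element outside [Q] lies after
   [e] on [P] while its [alpha] is still at most [tau]. *)
Lemma path_intervals_cover (R : realType) (E : finType)
    (N : abstract_network E) (rho mu a : E -> R) (P : {set E}) (tau : R) :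
  (forall e, 0 <= rho e) -> (forall e, 0 <= mu e) ->
  (forall Q : {set E}, Q \in paths N -> 1 <= \sum_(e in Q) (mu e + rho e)) ->
  (forall e, alpha N rho mu e = (a e)%:E) ->
  P \in paths N -> 0 <= tau < 1 ->
  exists2 e, e \in P & a e <= tau < a e + rho e + mu e.
Proof.
move=> rho0 mu0 heavy aE PN /andP[tau0 tau1].
have w0 e : 0 <= mu e + rho e by rewrite addr_ge0.
have before_le Q e : Q \in paths N -> e \in Q ->
    a e <= \sum_(f in path_before N Q e) (mu f + rho f).
  move=> QN eQ; rewrite -lee_fin -aE /alpha ge_min; apply/orP; left.
  by apply: (bigmin_inf Q); rewrite ?QN.
pose A := [set e in P | a e <= tau].
have AP : A \subset P by apply/fintype.subsetP => e; rewrite inE => /andP[].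
have P0 : P != finset.set0.
  apply/eqP => P0; have := heavy _ PN.
  by rewrite P0 big_set0 ler10.
(* Nothing precedes the first element of [P], so its [alpha] is at most [0]. *)
have A0 : A != finset.set0.
  have [m mP mmin] := path_first PN (subxx P) P0.
  apply/set0Pn; exists m; rewrite inE mP /=.
  apply: le_trans tau0; apply: le_trans (before_le _ _ PN mP) _.
  rewrite big1 // => f; rewrite inE => /andP[fP /andP[fm /negP[]]].
  by apply/eqP; apply: (network_le_anti PN) => //; rewrite fm mmin.
have [e eA emax] := path_last PN AP A0.
have [eP etau] : e \in P /\ a e <= tau by move: eA; rewrite inE => /andP.
exists e => //; rewrite etau /= ltNge; apply/negP => short.
have : (alpha N rho mu e <= (tau - mu e - rho e)%:E)%E.
  by rewrite aE lee_fin; lra.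
(* The bound cannot come from the cap [1 - rho e], which would force [1 + mu e <= tau]; so some path
   [Q] through [e] realises it. *)
rewrite /alpha ge_min lee_fin orbC => /orP[|].
  by have := mu0 e; lra.
move/bigmin_leP => -[//|[Q /andP[QN eQ]]]; rewrite lee_fin => Qshort.
pose Qe := [set q in Q | network_le N Q q e].
(* Including [e] adds back exactly the [mu e + rho e] subtracted from [tau] in the bound on the part
   of [Q] before [e]. *)
have Qe_short : \sum_(f in Qe) (mu f + rho f) <= tau.
  have rQe : network_le N Q e e.
    by have := network_le_total QN eQ eQ; rewrite orbb.
  rewrite (bigD1 e) /= ?inE ?eQ //.
  rewrite (eq_bigl (mem (path_before N Q e))); last first.
    by move=> f; rewrite !inE andbA.
  lra.
have [|T TN Tsub] := @path_switch _ N Q P e QN PN; first by rewrite inE eQ.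
have TQe0 : T :\: Qe != finset.set0.
  rewrite finset.setD_eq0; apply/negP => TQe.
  have := ler_sum_subset w0 TQe; have := heavy _ TN; lra.
have [g gTQ gmin] := path_first TN (finset.subsetDl T Qe) TQe0.
have [gQ gT] : g \notin Qe /\ g \in T by move: gTQ; rewrite inE => /andP.
have [gP eg] : g \in P /\ network_le N P e g.
  have := fintype.subsetP Tsub _ gT; rewrite finset.in_setU (negbTE gQ) /=.
  by rewrite inE => /andP.
(* Everything before [g] on [T] lies in [Qe], whose weight is at most [tau]. *)
have gtau : a g <= tau.
  apply: le_trans Qe_short; apply: le_trans (before_le _ _ TN gT) _.
  apply: ler_sum_subset => //; apply/fintype.subsetP => f.
  rewrite inE => /andP[fT /andP[fg fNg]]; apply: contraT => fQ.
  move/negP: fNg => []; apply/eqP; apply: (network_le_anti TN) => //.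
  by rewrite fg gmin // inE fQ.
(* The choice of [e] as last in [A] forces [g = e], yet [e] lies in [Qe] and [g] does not. *)
have ge : network_le N P g e by apply: emax; rewrite inE gP.
have eqge : g = e by apply: (network_le_anti PN) => //; rewrite ge eg.
move: gQ; rewrite eqge inE eQ /=.
by have := network_le_total QN eQ eQ; rewrite orbb => ->.
Qed.

(** * Uniform probability of intervals *)

Lemma uniform_prob01E (R : realType) (A : set R) : measurable A ->
  uniform_prob (@ltr01 R) A = lebesgue_measure (A `&` `[0, 1])%classic.
Proof.
move=> mA; rewrite /uniform_prob integral_uniform_pdf.
rewrite (eq_integral (fun=> 1%E)); last first.
  move=> x; rewrite inE /= => -[_]; rewrite in_itv /= /uniform_pdf => ->.
  by rewrite subr0 invr1.
by rewrite integral_cst ?mul1e //; exact: measurableI.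
Qed.

Lemma uniform_prob01_itvco (R : realType) (a b : R) :
  0 <= a -> a <= b -> b <= 1 ->
  uniform_prob (@ltr01 R) `[a, b[%classic = (b - a)%:E.
Proof.
move=> a0 ab b1; rewrite uniform_prob01E; last exact: measurable_itv.
rewrite setIidl; last first.
  by move=> x /=; rewrite !in_itv /= => /andP[ax xb]; lra.
rewrite lebesgue_measure_itv /= lte_fin; case: ltP => // ba.
by rewrite (_ : b - a = 0) //; lra.
Qed.

(** Only an upper bound, since an interval enlarged by [mu e] may stick out of [[0, 1]]. *)
Lemma uniform_prob01_itvco_le (R : realType) (a b : R) : a <= b ->
  (uniform_prob (@ltr01 R) `[a, b[%classic <= (b - a)%:E)%E.
Proof.
move=> ab; rewrite uniform_prob01E; last exact: measurable_itv.
apply: (@le_trans _ _ (lebesgue_measure `[a, b[%classic)).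
  by apply: le_measure; rewrite ?inE //; exact: measurableI.
rewrite lebesgue_measure_itv /= lte_fin; case: ltP => // _.
by rewrite lee_fin; lra.
Qed.

(** * Events defined by finite-valued maps *)

Lemma preimage_predE (T : Type) (I : finType) (F : T -> I) (p : pred I) :
  [set t | p (F t)]%classic =
  (\bigcup_(i in [set` enum p]) [set t | F t = i])%classic.
Proof.
apply/seteqP; split => [t pt|t [i /=]]; last by rewrite mem_enum => pi ->.
by exists (F t) => //=; rewrite mem_enum.
Qed.

Lemma measurable_preimage_pred (d : measure_display) (T : measurableType d)
    (I : finType) (F : T -> I) (p : pred I) :
  (forall i, measurable [set t | F t = i]%classic) ->
  measurable [set t | p (F t)]%classic.
Proof.
by move=> mF; rewrite preimage_predE; apply: fin_bigcup_measurable.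
Qed.

(** The fibres of [F] are disjoint and finite in number, so additivity applies. *)
Lemma sum_prob_preimage (d : measure_display) (T : measurableType d)
    (R : realType) (Pr : probability T R) (I : finType) (F : T -> I)
    (p : pred I) :
  (forall i, measurable [set t | F t = i]%classic) ->
  \sum_(i | p i) fine (Pr [set t | F t = i]%classic) =
  fine (Pr [set t | p (F t)]%classic).
Proof.
move=> mF; rewrite sum_fine; last first.
  by move=> i _; apply: fin_num_measure.
rewrite preimage_predE measure_fin_bigcup //; last first.
  by move=> i j _ _ [t [/= -> ->]].
by rewrite -fsbig_seq ?enum_uniq // big_enum.
Qed.

(** Prescribing [F t] amounts to one condition for each of the finitely many [e], namely a
    membership event or its complement. *)
Lemma measurable_set_valued (d : measure_display) (T : measurableType d)
    (E : finType) (F : T -> {set E}) (S : {set E}) :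
  (forall e, measurable [set t | e \in F t]%classic) ->
  measurable [set t | F t = S]%classic.
Proof.
move=> mF.
rewrite (_ : [set t | F t = S]%classic =
  (\bigcap_(e in setT) [set t | (e \in F t) = (e \in S)])%classic); last first.
  apply/seteqP; split => [t FtS e _ /=|t tS]; first by rewrite FtS.
  by apply/setP => e; exact: (tS e).
apply: fin_bigcap_measurable => [|e _]; first exact: finite_finset.
case: (e \in S); first exact: mF.
rewrite (_ : [set _ | _]%classic = (~` [set t | e \in F t])%classic).
  exact: measurableC.
by apply/seteqP; split => t /= => [->|/negP/negbTE].
Qed.

Unset Implicit Arguments.
Set Strict Implicit.

Theorem theorem3 (R : realType) (E : finType) (N : abstract_network E)
    (rho mu : E -> R)
    (rho01 : forall e, 0 <= rho e <= 1)
    (mu01 : forall e, 0 <= mu e <= 1)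
    (rho_mu : forall P : {set E}, P \in paths N ->
       requirement mu P <= \sum_(e in P) rho e) :
  feasible_decomposition N (requirement mu) rho
    (threshold_decomposition N rho mu).
Proof.
have rho0 e : 0 <= rho e by case/andP: (rho01 e).
have mu0 e : 0 <= mu e by case/andP: (mu01 e).
have [a aP] := alpha_finite N rho01 mu0.
have aE e : alpha N rho mu e = (a e)%:E by case: (aP e).
have a01 e : 0 <= a e /\ a e + rho e <= 1.
  by case: (aP e) => _ /andP[]; split => //; lra.
have heavy (Q : {set E}) : Q \in paths N -> 1 <= \sum_(e in Q) (mu e + rho e).
  by move=> /rho_mu; rewrite /requirement big_split /=; lra.
pose S := threshold_set N rho mu.
have memS e : [set t | e \in S t]%classic = `[a e, a e + rho e[%classic.
  apply/seteqP; split => t /=;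
    by rewrite /S /threshold_set inE aE in_itv /= lee_fin -EFinD lte_fin.
have mS A : measurable [set t | S t = A]%classic.
  by apply: measurable_set_valued => e; rewrite memS; exact: measurable_itv.
pose Pr : probability _ R := uniform_prob (@ltr01 R).
have sumE (p : pred {set E}) :
    \sum_(A | p A) threshold_decomposition N rho mu A =
    fine (Pr [set t | p (S t)]%classic) by exact: sum_prob_preimage.
split.
- by move=> A; rewrite fine_ge0 //; exact: (measure_ge0 Pr).
- by rewrite (sumE predT) [X in Pr X](_ : _ = setT) ?probability_setT //;
    exact/seteqP.
- move=> e; rewrite sumE memS.
  by case: (a01 e) => a0 a1; rewrite [Pr _]uniform_prob01_itvco //;
    have := rho0 e; rewrite /=; lra.
move=> P PN; rewrite (sumE (fun A => A :&: P != finset.set0)).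
set C := [set t | _]%classic.
have mC : measurable C.
  exact: (measurable_preimage_pred (fun A => A :&: P != finset.set0)).
(* [J e] is the piece added on the right of the interval of [e]; the union [D] of these over [P]
   must contain what [C] misses of [[0, 1)]. *)
pose J e : set R := `[a e + rho e, a e + rho e + mu e[%classic.
have mJ e : measurable (J e) by exact: measurable_itv.
pose D : set R := (\bigcup_(e in [set` enum P]) J e)%classic.
have mD : measurable D.
  by apply: fin_bigcup_measurable.
have PrD : (Pr D <= (\sum_(e in P) mu e)%:E)%E.
  apply: (@le_trans _ _ (\sum_(e \in [set` enum P]) Pr (J e))%E).
    by apply: content_sub_fsum => // e _; exact: mJ.
  rewrite -fsbig_seq ?enum_uniq // big_enum -sumEFin.
  apply: lee_sum => e _; apply: le_trans (uniform_prob01_itvco_le _) _.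
    by have := mu0 e; lra.
  by rewrite lee_fin; lra.
have cover : (`[0, 1[ `<=` C `|` D)%classic.
  move=> t /=; rewrite in_itv /= => t01.
  have [e eP] := path_intervals_cover rho0 mu0 heavy aE PN t01.
  move=> /andP[aet tlt]; have [tr|rt] := ltP t (a e + rho e).
    left; apply/set0Pn; exists e; rewrite inE eP andbT.
    have : `[a e, a e + rho e[%classic t by rewrite /= in_itv /= aet.
    by rewrite -memS.
  by right; exists e; rewrite /J /= ?mem_enum // in_itv /= rt.
(* [[0, 1)] already has probability [1], so leaving out [tau = 1] costs nothing. *)
have : (1%:E <= Pr C + Pr D)%E.
  rewrite -[X in X%:E](subr0 1) -uniform_prob01_itvco //.
  apply: (@le_trans _ _ (Pr (C `|` D)%classic)); last exact: measureU2.
  by apply: (le_measure Pr); rewrite ?inE //; exact: measurableU.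
have := PrD; rewrite -(fineK (fin_num_measure Pr C mC)).
rewrite -(fineK (fin_num_measure Pr D mD)) -EFinD !lee_fin /requirement; lra.
Qed.
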